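(* Let $n\ge 3$, $z\in\mathbb{C}\setminus\{0,1\}$, and let $\beta$ be the standard representation of the braid group $\mathcal{B}_n$ on $\mathbb{C}^n$ with parameter $z$. For every $t\in\mathbb{C}\setminus\{0\}$, the assignments $$\phi(\sigma_i)=\beta(\sigma_i)\ (1\le i\le n-1),\qquad \phi(\tau)=\begin{pmatrix}0&t^{-n+1}\\ t\,I_{n-1}&0\end{pmatrix},\qquad \phi(\sigma_n)=\phi(\tau)\phi(\sigma_{n-1})\phi(\tau)^{-1}$$ define a representation $\phi$ of the necklace braid group $\mathcal{NB}_n$ which is an extension of $\beta$. Moreover, if $t^{2n}\ne z^{-2(n-1)}$, then $\phi$ is not a standard extension of $\beta$, i.e. $\phi(\tau)$ is not a scalar multiple of $\beta(\gamma)$.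
   Context: The braid group $\mathcal{B}_n$ is generated by $\sigma_1,\dots,\sigma_{n-1}$ with relations $\sigma_i\sigma_{i+1}\sigma_i=\sigma_{i+1}\sigma_i\sigma_{i+1}$ and $\sigma_i\sigma_j=\sigma_j\sigma_i$ for $|i-j|>1$. Put $\gamma=\sigma_1\sigma_2\cdots\sigma_{n-1}$. The standard representation $\beta$ of $\mathcal{B}_n$ on $\mathbb{C}^n$ with parameter $z$ is $\beta(\sigma_i)=I_{i-1}\oplus\begin{pmatrix}0&z\\1&0\end{pmatrix}\oplus I_{n-i-1}$, where $I_k$ is the $k\times k$ identity matrix. The necklace braid group $\mathcal{NB}_n$ is the group with generators $\sigma_1,\dots,\sigma_n,\tau$ and relations, with all indices taken modulo $n$: (B1) $\sigma_i\sigma_{i+1}\sigma_i=\sigma_{i+1}\sigma_i\sigma_{i+1}$ for all $i$; (B2) $\sigma_i\sigma_j=\sigma_j\sigma_i$ whenever $i-j\not\equiv\pm1\pmod n$; (N1) $\tau\sigma_i\tau^{-1}=\sigma_{i+1}$ for $1\le i\le n$; (N2) $\tau^{2n}=1$. An extension of a representation of $\mathcal{B}_n$ is a representation of $\mathcal{NB}_n$ agreeing with it on $\sigma_1,\dots,\sigma_{n-1}$. A representation $\rho$ of $\mathcal{NB}_n$ is a standard extension (of its restriction to $\mathcal{B}_n$) if $\rho(\tau)=A\rho(\gamma)$ for some operator $A$ commuting with all $\rho(\sigma_i)$. *)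

(* Defs.v *)
From HB Require Import structures.
From mathcomp Require Import all_boot all_order all_algebra.
From mathcomp Require Import complex boolp reals.

Set Implicit Arguments.
Unset Strict Implicit.
Unset Printing Implicit Defensive.

Import GRing.Theory.
Local Open Scope ring_scope.

(* Groups given by generators and relations: words in the letters x^{+-1},
   modulo the congruence generated by free cancellation and the relations. *)

(* The boolean marks inverse letters. *)
Definition word (X : choiceType) := seq (X * bool).

Definition letter (X : choiceType) (x : X) : X * bool := (x, false).
Definition letterV (X : choiceType) (x : X) : X * bool := (x, true).

Inductive pres_eq (X : choiceType) (r : word X -> word X -> Prop) :
    word X -> word X -> Prop :=
| PresRefl u : pres_eq r u u
| PresSym u v of pres_eq r u v : pres_eq r v u
| PresTrans u v w of pres_eq r u v & pres_eq r v w : pres_eq r u w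
| PresCat u u' v v' of pres_eq r u u' & pres_eq r v v' :
    pres_eq r (u ++ v) (u' ++ v')
| PresCancel x b : pres_eq r [:: (x, b); (x, ~~ b)] [::]
| PresRel u v of r u v : pres_eq r u v.

Section PresentedGroup.
Variables (X : choiceType) (r : word X -> word X -> Prop).

Definition pres_eqb : rel (word X) := fun u v => `[< pres_eq r u v >].

Lemma pres_eqb_refl : reflexive pres_eqb.
Proof. by move=> u; apply/asboolP; apply: PresRefl. Qed.

Lemma pres_eqb_sym : symmetric pres_eqb.
Proof. by move=> u v; apply/asboolP/asboolP; apply: PresSym. Qed.

Lemma pres_eqb_trans : transitive pres_eqb.
Proof.
by move=> v u w /asboolP uv /asboolP vw; apply/asboolP; apply: PresTrans uv vw.
Qed.

Canonical pres_equiv := EquivRel pres_eqb pres_eqb_refl pres_eqb_sym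
  pres_eqb_trans.

Definition presented : Type := {eq_quot pres_equiv}%qT.
HB.instance Definition _ := Choice.on presented.
HB.instance Definition _ := Quotient.on presented.

Definition pres_class (u : word X) : presented := (\pi_presented u)%qT.

Lemma pres_classP u v : pres_class u = pres_class v <-> pres_eq r u v.
Proof.
split=> [/(@eqmodP _ pres_equiv)/asboolP // | uv].
by apply/(@eqmodP _ pres_equiv)/asboolP.
Qed.

Lemma pres_reprK g : pres_class (repr g) = g.
Proof. exact: reprK. Qed.

Definition word_inv (u : word X) : word X := rev [seq (a.1, ~~ a.2) | a <- u].

Lemma word_inv_cat u v : word_inv (u ++ v) = word_inv v ++ word_inv u.
Proof. by rewrite /word_inv map_cat rev_cat. Qed.

Lemma word_mulVK u : pres_eq r (word_inv u ++ u) [::].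
Proof.
elim: u => [|[x b] u IHu]; first exact: PresRefl.
rewrite -cat1s word_inv_cat -catA [X in pres_eq _ (_ ++ X) _]catA.
apply: PresTrans IHu; apply: PresCat; first exact: PresRefl.
rewrite -[X in pres_eq _ _ X]cat0s; apply: PresCat; last exact: PresRefl.
by rewrite /word_inv /= -{2}[b]negbK; apply: PresCancel.
Qed.

Lemma word_invK : involutive word_inv.
Proof.
move=> u; rewrite /word_inv map_rev revK -map_comp -[RHS]map_id.
by apply: eq_map => -[x b] /=; rewrite negbK.
Qed.

Definition pres_one : presented := pres_class [::].
Definition pres_mul (g h : presented) : presented :=
  pres_class (repr g ++ repr h).
Definition pres_inv (g : presented) : presented :=
  pres_class (word_inv (repr g)).

Lemma pres_repr u : pres_eq r (repr (pres_class u)) u.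
Proof. by apply/pres_classP; rewrite pres_reprK. Qed.

Lemma pres_mulE u v :
  pres_mul (pres_class u) (pres_class v) = pres_class (u ++ v).
Proof. by apply/pres_classP/PresCat; apply: pres_repr. Qed.

Lemma pres_mulA : associative pres_mul.
Proof.
move=> a b c; rewrite -(pres_reprK a) -(pres_reprK b) -(pres_reprK c).
by rewrite !pres_mulE catA.
Qed.

Lemma pres_mul1 : left_id pres_one pres_mul.
Proof. by move=> a; rewrite -(pres_reprK a) pres_mulE. Qed.

Lemma pres_mulr1 : right_id pres_one pres_mul.
Proof. by move=> a; rewrite -(pres_reprK a) pres_mulE cats0. Qed.

Lemma pres_mulV : left_inverse pres_one pres_inv pres_mul.
Proof.
move=> a; rewrite -[X in pres_mul _ X]pres_reprK /pres_inv pres_mulE.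
exact/pres_classP/word_mulVK.
Qed.

Lemma pres_mulrV : right_inverse pres_one pres_inv pres_mul.
Proof.
move=> a; rewrite -[X in pres_mul X]pres_reprK /pres_inv pres_mulE.
by apply/pres_classP; rewrite -{1}[repr a]word_invK; apply: word_mulVK.
Qed.

HB.instance Definition _ := isGroup.Build presented
  pres_mulA pres_mul1 pres_mulr1 pres_mulV pres_mulrV.

Definition pres_gen (x : X) : presented := pres_class [:: letter x].

End PresentedGroup.

(* As mx_repr for finite groups: the values are automatically invertible. *)
Definition representation (F : fieldType) (G : groupType) (n : nat)
    (rho : G -> 'M[F]_n) : Prop :=
  rho 1%g = 1%:M /\ forall g h : G, rho (g * h)%g = rho g *m rho h.

Section PresentedRepresentation.
Variables (F : fieldType) (n : nat) (X : choiceType).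
Variables (r : word X -> word X -> Prop) (f : X -> 'M[F]_n).

Definition word_eval (u : word X) : 'M[F]_n :=
  foldr (fun a M => (if a.2 then invmx (f a.1) else f a.1) *m M) 1%:M u.

Lemma word_eval_cat u v : word_eval (u ++ v) = word_eval u *m word_eval v.
Proof.
by elim: u => [|a u IHu] /=; rewrite ?mul1mx // [LHS]/= IHu mulmxA.
Qed.

Lemma presented_representation :
    (forall x, f x \in unitmx) ->
    (forall u v, r u v -> word_eval u = word_eval v) ->
  exists rho : presented r -> 'M[F]_n,
    representation rho /\ forall x, rho (pres_gen r x) = f x.
Proof.
move=> fU fr.
have evalP u v : pres_eq r u v -> word_eval u = word_eval v.
  elim=> {u v} // [u v w _ -> _ -> //|u u' v v' _ Hu _ Hv|x b].
    by rewrite !word_eval_cat Hu Hv.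
  by rewrite /word_eval; case: b; rewrite /= mulmx1 ?mulVmx ?mulmxV.
exists (fun g => word_eval (repr g)); split; last first.
  by move=> x; rewrite (evalP _ _ (pres_repr _ _)) /= mulmx1.
split=> [|g h]; first by rewrite (evalP _ _ (pres_repr _ _)).
by rewrite (evalP _ _ (pres_repr _ _)) word_eval_cat.
Qed.

End PresentedRepresentation.

(* The generator i : 'I_n.-1 is sigma_(i+1). *)
Inductive braid_rel (n : nat) : word 'I_n.-1 -> word 'I_n.-1 -> Prop :=
| BraidB1 (i j : 'I_n.-1) of j = i.+1 :> nat :
    braid_rel [:: letter i; letter j; letter i] [:: letter j; letter i; letter j]
| BraidB2 (i j : 'I_n.-1) of (i.+1 < j)%N || (j.+1 < i)%N :
    braid_rel [:: letter i; letter j] [:: letter j; letter i].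

Definition braid (n : nat) : groupType := presented (@braid_rel n).

Definition braid_sigma (n : nat) (i : 'I_n.-1) : braid n :=
  pres_gen (@braid_rel n) i.

Definition braid_gamma (n : nat) : braid n :=
  (\prod_(i < n.-1) braid_sigma i)%g.

(* Generators of NB_n, for n > 1: the residue i : 'Z_n stands for sigma_i, so
   that sigma_n is the residue n%:R = 0. *)
Definition necklace_gen (n : nat) : choiceType := ('Z_n + unit)%type.
Definition gsigma (n : nat) (i : 'Z_n) : necklace_gen n := inl i.
Definition gtau (n : nat) : necklace_gen n := inr tt.

Inductive necklace_rel (n : nat) :
    word (necklace_gen n) -> word (necklace_gen n) -> Prop :=
| NecklaceB1 (i : 'Z_n) : necklace_rel
    [:: letter (gsigma i); letter (gsigma (i + 1)); letter (gsigma i)]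
    [:: letter (gsigma (i + 1)); letter (gsigma i); letter (gsigma (i + 1))]
| NecklaceB2 (i j : 'Z_n) of i - j != 1 & i - j != - 1 : necklace_rel
    [:: letter (gsigma i); letter (gsigma j)]
    [:: letter (gsigma j); letter (gsigma i)]
| NecklaceN1 (i : 'Z_n) : necklace_rel
    [:: letter (gtau n); letter (gsigma i); letterV (gtau n)]
    [:: letter (gsigma (i + 1))]
| NecklaceN2 : necklace_rel (nseq (2 * n)%N (letter (gtau n))) [::].

Definition necklace (n : nat) : groupType := presented (@necklace_rel n).

Definition necklace_sigma (n : nat) (i : 'Z_n) : necklace n :=
  pres_gen (@necklace_rel n) (gsigma i).

Definition necklace_tau (n : nat) : necklace n :=
  pres_gen (@necklace_rel n) (gtau n).

Definition necklace_gamma (n : nat) : necklace n :=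
  (\prod_(i < n.-1) necklace_sigma (i.+1%:R : 'Z_n))%g.

Lemma sigma_dim (n : nat) (i : 'I_n.-1) : (i + (2 + (n - i.+2)) = n)%N.
Proof. by rewrite addnA addn2 subnKC // -ltn_predRL. Qed.

Definition sigma_block (F : fieldType) (z : F) : 'M[F]_2 :=
  block_mx (0 : 'M_1) z%:M 1%:M (0 : 'M_1).

Definition sigma_mx (F : fieldType) (n : nat) (z : F) (i : 'I_n.-1) : 'M[F]_n :=
  castmx (sigma_dim i, sigma_dim i)
    (block_mx (1%:M : 'M_i) 0
              0 (block_mx (sigma_block z) 0
                          0 (1%:M : 'M_(n - i.+2)))).

Definition standard_representation (F : fieldType) (n : nat) (z : F)
    (beta : braid n -> 'M[F]_n) : Prop :=
  representation beta /\ forall i, beta (braid_sigma i) = sigma_mx z i.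

(* See tau_mx_block for the block form. *)
Definition tau_mx (F : fieldType) (n : nat) (t : F) : 'M[F]_n :=
  \matrix_(j < n, k < n)
    (if (j == 0 :> nat) && (k.+1 == n) then t ^- n.-1
     else if j == k.+1 :> nat then t else 0).

Definition is_extension (F : fieldType) (n : nat) (beta : braid n -> 'M[F]_n)
    (rho : necklace n -> 'M[F]_n) : Prop :=
  representation rho /\
  forall i : 'I_n.-1, rho (necklace_sigma i.+1%:R) = beta (braid_sigma i).

Definition standard_extension (F : fieldType) (n : nat)
    (beta : braid n -> 'M[F]_n) (rho : necklace n -> 'M[F]_n) : Prop :=
  is_extension beta rho /\
  exists A : 'M[F]_n,
    (forall i : 'Z_n, comm_mx A (rho (necklace_sigma i))) /\
    rho (necklace_tau n) = A *m rho (necklace_gamma n).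

Section Monomial.
Variables (F : fieldType) (n : nat).
Implicit Types (f g : 'I_n -> F) (s : 'I_n -> 'I_n).

Lemma sigma_mxE (z : F) (i : 'I_n.-1) (a b : 'I_n) :
  sigma_mx z i a b =
    if a == i :> nat then (if b == i.+1 :> nat then z else 0)
    else if a == i.+1 :> nat then (b == i :> nat)%:R
    else (a == b)%:R.
Proof.
have -> : (a == b) = (a == b :> nat) by [].
rewrite castmxE /=; set a' := cast_ord _ a; set b' := cast_ord _ b.
have [-> ->] : a = a' :> nat /\ b = b' :> nat by [].
move: a' b' => {}a {}b; rewrite !mxE.
case: splitP => [a1 ->|a1 ->]; rewrite !mxE; case: splitP => [b1 ->|b1 ->] /=.
- by rewrite mxE ltn_eqF // ltn_eqF // leqW.
- rewrite mxE ltn_eqF // ltn_eqF ?leqW //.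
  by rewrite [(_ == _)%N]ltn_eqF // ltn_addr.
- have b1i : (b1 == i :> nat) = false by rewrite ltn_eqF.
  have b1i1 : (b1 == i.+1 :> nat) = false by rewrite ltn_eqF // leqW.
  have b1a : ((i + a1)%N == b1) = false by rewrite gtn_eqF // ltn_addr.
  by rewrite mxE b1i b1i1 b1a /= !if_same.
have e0 c : ((i + c)%N == i) = (c == 0)%N.
  by rewrite -[X in (_ == X)%N]addn0 eqn_add2l.
have e1 c : ((i + c)%N == i.+1) = (c == 1)%N by rewrite -addn1 eqn_add2l.
rewrite !e0 !e1 eqn_add2l [LHS]mxE.
case: splitP => [a2 ->|a2 ->]; rewrite !mxE; case: splitP => [b2 ->|b2 ->] /=.
- rewrite /sigma_block mxE.
  case: splitP => [a3 ->|a3 ->]; rewrite mxE; case: splitP => [b3 ->|b3 ->];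
    by rewrite ?ord1 /= !mxE ?eqxx.
- by rewrite mxE; case: a2 => -[|[|]].
- by rewrite mxE; case: b2 => -[|[|]].
- by rewrite mxE eqn_add2l.
Qed.

Lemma tau_mx_block (m : nat) (t : F) :
  tau_mx m.+1 t =
    castmx (erefl, addn1 m)
      (block_mx (0 : 'M_(1, m)) (t ^- m)%:M t%:M (0 : 'M_(m, 1))).
Proof.
apply/matrixP => j k; rewrite castmxE /= cast_ord_id mxE.
set k' := cast_ord _ k; have -> : k = k' :> nat by [].
move: k' => {}k; rewrite [RHS]mxE.
case: (@splitP 1 m j) => [j1 ->|j1 ->]; rewrite !mxE.
  rewrite ord1 /= ; case: splitP => [k1 ->|k1 ->]; rewrite !mxE.
    by rewrite eqSS ltn_eqF.
  by rewrite !ord1 addn0 !eqxx.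
rewrite /= add1n eqSS; case: splitP => [k1 ->|k1 ->]; rewrite !mxE.
  by case: eqVneq => [/val_inj ->|]; rewrite ?eqxx // => /negPf H;
     rewrite -val_eqE H.
by rewrite ord1 addn0 ltn_eqF.
Qed.

Let mono f s : 'M[F]_n := \matrix_(a, b) (f a *+ (b == s a)).

Let mono_mul f g s s' :
  mono f s *m mono g s' = mono (fun a => f a * g (s a)) (s' \o s).
Proof.
apply/matrixP => a b; rewrite !mxE (bigD1 (s a)) //= big1 => [|c /negPf cs].
  by rewrite !mxE eqxx addr0 mulr1n mulrnAr.
by rewrite !mxE cs mul0r.
Qed.

Let eq_mono f g s s' : f =1 g -> s =1 s' -> mono f s = mono g s'.
Proof. by move=> fg ss; apply/matrixP => a b; rewrite !mxE fg ss. Qed.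

Let swap (p q a : 'I_n) := if a == p then q else if a == q then p else a.
Let wt (z : F) (p a : 'I_n) := if a == p then z else 1.

Let pt1 (i : 'I_n.-1) : 'I_n := widen_ord (leq_pred n) i.
Let pt2 (i : 'I_n.-1) : 'I_n := Ordinal (etrans (esym (ltn_predRL i n)) (ltn_ord i)).

Let sigma_mono z i : sigma_mx z i = mono (wt z (pt1 i)) (swap (pt1 i) (pt2 i)).
Proof.
apply/matrixP => a b; rewrite sigma_mxE mxE /wt /swap -!val_eqE /=.
case: (eqVneq (val a) i) => ai.
  by rewrite -[X in z *+ X]/(nat_of_bool (b == i.+1 :> nat)); case: (_ == _).
by case: (nat_of_ord a == i.+1) => //; rewrite [in RHS]eq_sym.
Qed.

Lemma standard_representation_exists (z : F) :
  z != 0 -> exists beta : braid n -> 'M[F]_n, standard_representation z beta.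
Proof.
move=> z0; apply: presented_representation => [i|u v].
  rewrite sigma_mono.
  suff /mulmx1_unit[] : mono (wt z (pt1 i)) (swap (pt1 i) (pt2 i)) *m
      mono (wt z^-1 (pt2 i)) (swap (pt1 i) (pt2 i)) = 1%:M by [].
  have d : pt2 i != pt1 i by rewrite -val_eqE /= gtn_eqF.
  apply/matrixP => a b; rewrite mono_mul !mxE /= /wt /swap.
  case: (eqVneq a (pt1 i)) => [->|a1].
    by rewrite (negPf d) eqxx divff // eq_sym.
  case: (eqVneq a (pt2 i)) => [->|a2].
    by rewrite eqxx mul1r [pt1 i == _]eq_sym (negPf d) eq_sym.
  by rewrite (negPf a1) (negPf a2) mul1r eq_sym.
case=> [i j ji|i j ij] /=; rewrite !sigma_mono !mulmx1 !mono_mul.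
  have -> : pt1 j = pt2 i by apply: val_inj.
  have d1 : (pt1 i == pt2 i) = false by rewrite -val_eqE /= ltn_eqF.
  have d2 : (pt1 i == pt2 j) = false by rewrite -val_eqE /= ji ltn_eqF // leqW.
  have d3 : (pt2 i == pt2 j) = false by rewrite -val_eqE /= ji ltn_eqF.
  move: (pt1 i) (pt2 i) (pt2 j) d1 d2 d3 => p q r d1 d2 d3.
  have e1 : (q == p) = false by rewrite eq_sym.
  have e2 : (r == p) = false by rewrite eq_sym.
  have e3 : (r == q) = false by rewrite eq_sym.
  pose d := (d1, d2, d3, e1, e2, e3, eqxx, mulr1, mul1r).
  apply: eq_mono => a; rewrite /= /swap /wt.
    case: (eqVneq a p) => [e|/negPf ap]; first by do 4!rewrite ?e ?d /=.
    case: (eqVneq a q) => [e|/negPf aq]; first by do 4!rewrite ?e ?d /=.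
    case: (eqVneq a r) => [e|/negPf ar]; first by do 4!rewrite ?e ?d /=.
    by do 4!rewrite ?(d, ap, aq, ar) /=.
  case: (eqVneq a p) => [e|/negPf ap]; first by do 4!rewrite ?e ?d /=.
  case: (eqVneq a q) => [e|/negPf aq]; first by do 4!rewrite ?e ?d /=.
  case: (eqVneq a r) => [e|/negPf ar]; first by do 4!rewrite ?e ?d /=.
  by do 4!rewrite ?(d, ap, aq, ar) /=.
have d1 : (pt1 i == pt1 j) = false.
  by rewrite -val_eqE /=; apply/eqP => e; move: ij; rewrite e ltnNge leqnSn.
have d2 : (pt1 i == pt2 j) = false.
  rewrite -val_eqE /=; apply/eqP => e; move: ij.
  by rewrite e ltnn ltnNge -addn2 leq_addr.
have d3 : (pt2 i == pt1 j) = false.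
  rewrite -val_eqE /=; apply/eqP => e; move: ij.
  by rewrite -e ltnn ltnNge -addn2 leq_addr.
have d4 : (pt2 i == pt2 j) = false by move: d1; rewrite -!val_eqE /= eqSS.
have d5 k : (pt1 k == pt2 k) = false by rewrite -val_eqE /= ltn_eqF.
move: (pt1 i) (pt2 i) (pt1 j) (pt2 j) (d5 i) (d5 j) d1 d2 d3 d4.
move=> p q r t {}d5 d6 d1 d2 d3 d4.
have e5 : (q == p) = false by rewrite eq_sym.
have e6 : (t == r) = false by rewrite eq_sym.
have e1 : (r == p) = false by rewrite eq_sym.
have e2 : (t == p) = false by rewrite eq_sym.
have e3 : (r == q) = false by rewrite eq_sym.
have e4 : (t == q) = false by rewrite eq_sym.
pose d := (d1, d2, d3, d4, d5, d6, e1, e2, e3, e4, e5, e6, eqxx, mulr1, mul1r).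
apply: eq_mono => a; rewrite /= /swap /wt.
  case: (eqVneq a p) => [e|/negPf ap]; first by do 4!rewrite ?e ?d /=.
  case: (eqVneq a q) => [e|/negPf aq]; first by do 4!rewrite ?e ?d /=.
  case: (eqVneq a r) => [e|/negPf ar]; first by do 4!rewrite ?e ?d /=.
  case: (eqVneq a t) => [e|/negPf ant]; first by do 4!rewrite ?e ?d /=.
  by do 4!rewrite ?(d, ap, aq, ar, ant) /=.
case: (eqVneq a p) => [e|/negPf ap]; first by do 4!rewrite ?e ?d /=.
case: (eqVneq a q) => [e|/negPf aq]; first by do 4!rewrite ?e ?d /=.
case: (eqVneq a r) => [e|/negPf ar]; first by do 4!rewrite ?e ?d /=.
case: (eqVneq a t) => [e|/negPf ant]; first by do 4!rewrite ?e ?d /=.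
by do 4!rewrite ?(d, ap, aq, ar, ant) /=.
Qed.

End Monomial.

(* Main.v *)
Require Import Defs.
From mathcomp Require Import all_boot all_order all_algebra.
From mathcomp Require Import complex boolp reals.

Set Implicit Arguments.
Unset Strict Implicit.
Unset Printing Implicit Defensive.

Import GRing.Theory.
Local Open Scope ring_scope.

(** The matrix [phi tau] is [D P D^-1] with [P] the cyclic permutation matrix
    and [D = diag (1, t, ..., t^(n-1))]; hence [(phi tau)^n = 1], and
    conjugation by [phi tau] shifts [beta sigma_i] to [beta sigma_(i+1)].
    Setting [phi sigma_i := phi(tau)^(i-1) beta(sigma_1) phi(tau)^(1-i)] is
    therefore meaningful for residues [i], and each relation of the necklace
    group is a conjugate of a braid relation. If [phi tau = A (phi gamma)]
    with [A] commuting with [sigma_1], comparing the images of the first and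
    last basis vectors, which [gamma] sends to [e_2] and [z^(n-1) e_1], gives
    [z^(n-1) t^n = 1]. *)

(** * Representations of groups given by generators and relations *)

Section Representations.
Variables (F : fieldType) (n : nat).

Lemma representation_mulV (G : groupType) (rho : G -> 'M[F]_n) (g : G) :
  representation rho -> rho g *m rho (g^-1)%g = 1%:M.
Proof. by case=> rho1 rhoM; rewrite -rhoM mulgV. Qed.

Lemma representation_unit (G : groupType) (rho : G -> 'M[F]_n) (g : G) :
  representation rho -> rho g \in unitmx.
Proof. by move=> rhoP; case: (mulmx1_unit (representation_mulV g rhoP)). Qed.

Lemma representation_inv (G : groupType) (rho : G -> 'M[F]_n) (g : G) :
  representation rho -> rho (g^-1)%g = invmx (rho g).
Proof.
move=> rhoP; rewrite -[LHS](mulKmx (representation_unit g rhoP)).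
by rewrite representation_mulV // mulmx1.
Qed.

Lemma representation_prod (G : groupType) (rho : G -> 'M[F]_n) (k : nat)
    (g : 'I_k -> G) :
  representation rho ->
  rho (\prod_(i < k) g i)%g = \prod_(i < k) rho (g i).
Proof. by case=> rho1 rhoM; apply: (big_morph rho rhoM rho1). Qed.

Lemma pres_class_letterV (X : choiceType) (r : word X -> word X -> Prop) x :
  pres_class r [:: letterV x] = (pres_gen r x)^-1%g.
Proof.
apply: (mulgI (pres_gen r x)); rewrite mulgV [LHS]pres_mulE.
exact/pres_classP/PresCancel.
Qed.

(** Values on inverse letters are forced as well, since a representation sends inverses to inverse
    matrices. This gives the uniqueness of [phi]. *)
Lemma representation_ext (X : choiceType) (r : word X -> word X -> Prop)
    (rho rho' : presented r -> 'M[F]_n) :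
  representation rho -> representation rho' ->
  (forall x, rho (pres_gen r x) = rho' (pres_gen r x)) -> rho = rho'.
Proof.
move=> rhoP rhoP' rhoE; apply/funext => g; rewrite -(pres_reprK g).
elim: (repr g) => [|[x b] u IHu]; first by rewrite rhoP.1 rhoP'.1.
rewrite -cat1s -pres_mulE rhoP.2 rhoP'.2 IHu; congr (_ *m _).
case: b; last exact: rhoE.
by rewrite pres_class_letterV !representation_inv // rhoE.
Qed.

End Representations.

(** * Powers of the matrix of tau and its conjugation action *)

Section NecklaceMatrices.
Variables (F : fieldType) (m : nat) (z t : F).
Hypothesis t0 : t != 0.

Local Notation n := m.+3.
Local Notation T := (tau_mx n t).
Local Notation S := (@sigma_mx F n z).
Local Notation e k := (delta_mx k 0 : 'cV[F]_n).

Let ord_eqE (j k : 'I_n) : (j == k) = (j == k :> nat).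
Proof. by []. Qed.

Lemma val_ordD1 (k : 'I_n) :
  (k + 1 : 'I_n) = (if k == m.+2 :> nat then 0 else k.+1) :> nat.
Proof.
have -> : (k + 1 : 'I_n) = (k.+1 %% n)%N :> nat.
  by rewrite /= [(1 %% _)%N]modn_small // addn1.
have [->|km] := eqVneq (k : nat) m.+2; first by rewrite modnn.
by rewrite modn_small // ltn_neqAle eqSS km ltn_ord.
Qed.

Lemma val_ordD1_eq (k : 'I_n) (i : nat) :
  (i < m.+2)%N -> ((k + 1 : 'I_n) == i.+1 :> nat) = (k == i :> nat).
Proof.
move=> im; rewrite val_ordD1.
by have [->|_] := eqVneq (k : nat) m.+2; first by rewrite [RHS]gtn_eqF.
Qed.

(** This is the form [D P D^-1], with [k + 1] taken modulo [n]: the corner entry is the wrap-around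
    case [j = 0], [k = n - 1], where the quotient is [t^-(n-1)]. *)
Lemma tau_mxE (j k : 'I_n) :
  tau_mx n t j k = (t ^+ j / t ^+ k) *+ (j == k + 1).
Proof.
rewrite mxE ord_eqE val_ordD1 eqSS.
have [km|km] := eqVneq (k : nat) m.+2.
  rewrite km andbT; case: eqP => [->|_]; first by rewrite expr0 mul1r.
  by rewrite ltn_eqF.
by rewrite andbF; case: eqP => // ->; rewrite exprS mulfK // expf_neq0.
Qed.

(** The diagonal factors telescope in [D P^q D^-1]. *)
Lemma tau_mx_expE (q : nat) (j k : 'I_n) :
  (T ^+ q) j k = (t ^+ j / t ^+ k) *+ (j == k + q%:R).
Proof.
elim: q j k => [|q IHq] j k.
  rewrite expr0 mxE addr0; case: eqP => // ->.
  by rewrite divff // expf_neq0.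
rewrite exprSr mxE (bigD1 (k + 1)) //= big1 => [|i /negPf ik].
  rewrite addr0 IHq tau_mxE eqxx mulr1n -addrA nat1r mulrnAl.
  by rewrite mulrA divfK // expf_neq0.
by rewrite tau_mxE ik mulr0.
Qed.

Lemma tau_mx_expn : T ^+ n = 1%:M.
Proof.
apply/matrixP => j k; rewrite tau_mx_expE -(@Zp_nat_mod n) // modnn addr0 mxE.
by case: eqP => // ->; rewrite divff // expf_neq0.
Qed.

Lemma tau_mx_unit : T \in unitmx.
Proof. by case: (@mulmx1_unit _ _ T (T ^+ m.+2)); rewrite -?tau_mx_expn. Qed.

Lemma tau_sigma (i j : 'I_m.+2) :
  j = i.+1 :> nat -> T *m S i = S j *m T.
Proof.
move=> ji; apply/matrixP => a b.
(* As [T] is monomial, each product has at most one nonzero term. With [a = c + 1], the entry of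
   [S j] at [(c + 1, b + 1)] is that of [S i] at [(c, b)]. The two weights from [T] agree where this
   entry is nonzero: for [c = b] trivially, and otherwise [c] and [b] are [i] and [i + 1], before
   the wrap-around, so both weights are [t]. *)
rewrite [LHS]mxE (bigD1 (a - 1)) //= big1 => [|c /negPf ca]; last first.
  by rewrite tau_mxE -subr_eq eq_sym ca mul0r.
rewrite [RHS]mxE (bigD1 (b + 1)) //= big1 => [|c /negPf cb]; last first.
  by rewrite tau_mxE cb mulr0.
rewrite !addr0 !tau_mxE subrK !eqxx !mulr1n.
move: (a - 1) (subrK 1 a) => c <- {a}.
have im : (i.+1 < m.+2)%N by rewrite -ji.
rewrite !sigma_mxE ji !val_ordD1_eq ?(ltnW im) // (inj_eq (addIr _)) !val_ordD1.
have t1 k : t ^+ k.+1 / t ^+ k = t by rewrite exprS mulfK // expf_neq0.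
have [ci|ci] := eqVneq (c : nat) i; first have [bi|bi] := eqVneq (b : nat) i.+1.
- by rewrite ci bi !ltn_eqF // ?t1 1?mulrC // ltnW.
- by rewrite mulr0 mul0r.
have [ci1|ci1] := eqVneq (c : nat) i.+1; first have [bi|bi] := eqVneq (b : nat) i.
- by rewrite ci1 bi !ltn_eqF // ?t1 1?mulrC // ltnW.
- by rewrite mulr0 mul0r.
by have [->|_] := eqVneq c b; [rewrite mulrC | rewrite mulr0 mul0r].
Qed.

(** * The shifted generators *)

Definition tau_conj (M : 'M[F]_n) : 'M[F]_n := T *m M *m invmx T.

Lemma tau_conjM : {morph tau_conj : M N / M *m N}.
Proof.
move=> M N; rewrite /tau_conj -!mulmxA; congr (_ *m (_ *m _)).
by rewrite mulKmx // tau_mx_unit.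
Qed.

Lemma iter_tau_conjM k : {morph iter k tau_conj : M N / M *m N}.
Proof. by elim: k => // k IHk M N; rewrite !iterS IHk tau_conjM. Qed.

Lemma iter_tau_conjE k M : iter k tau_conj M *m T ^+ k = T ^+ k *m M.
Proof.
elim: k => [|k IHk]; first by rewrite expr0 mulmx1 mul1mx.
by rewrite iterS exprS {1}/tau_conj -mulmxA mulKmx ?tau_mx_unit // -mulmxA IHk mulmxA.
Qed.

Lemma iter_tau_conj_n M : iter n tau_conj M = M.
Proof. by rewrite -[RHS]mul1mx -tau_mx_expn -iter_tau_conjE tau_mx_expn mulmx1. Qed.

Lemma iter_tau_conj_mod k M : iter (k %% n)%N tau_conj M = iter k tau_conj M.
Proof.
rewrite [in RHS](divn_eq k n) addnC iterD; congr iter.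
by elim: (k %/ n)%N => // q IHq; rewrite mulSn addnC iterD iter_tau_conj_n -IHq.
Qed.

(** The exponent [i - 1] is computed among residues, so sigma_n, whose residue is 0, gets the
    exponent [n - 1]. *)
Definition necklace_mx (x : necklace_gen n) : 'M[F]_n :=
  if x is inl i then iter ((i : 'I_n) - 1)%R tau_conj (S ord0) else T.

Arguments necklace_mx : simpl never.

Lemma necklace_mxE (i : 'Z_n) :
  necklace_mx (gsigma i) = iter ((i : 'I_n) - 1)%R tau_conj (S ord0).
Proof. by []. Qed.

(** Relation (N1) for all residues at once. The exponent [a + 1] may equal [n]; it need not be
    reduced, because the iterates have period [n]. *)
Lemma necklace_mxD1 (i : 'Z_n) (a := (i - 1 : 'I_n) : nat) :
  necklace_mx (gsigma (i + 1)) = iter a.+1 tau_conj (S ord0).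
Proof.
rewrite -iter_tau_conj_mod /necklace_mx /gsigma addrK /a.
move: (i - 1) (subrK 1 i) => c <-.
by congr iter; rewrite -[RHS](val_Zp_nat (p := n)) // -natr1 natr_Zp.
Qed.

Lemma iter_tau_conj_sigma (i : 'I_m.+2) :
  iter i tau_conj (S ord0) = S i.
Proof.
case: i => i im; elim: i im => [|i IHi] im /=; first by congr S; apply: val_inj.
rewrite (IHi (ltnW im)) /tau_conj (@tau_sigma _ (Ordinal im)) //.
by rewrite mulmxK // tau_mx_unit.
Qed.

Lemma necklace_mx_sigma (i : 'I_m.+2) :
  necklace_mx (gsigma (i.+1%:R : 'Z_n)) = S i.
Proof.
rewrite -iter_tau_conj_sigma /necklace_mx /gsigma -natr1 addrK.
by congr iter; rewrite (@val_Zp_nat n) // modn_small // ltnW // ltnS.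
Qed.

Lemma necklace_mx_unit : S ord0 \in unitmx -> forall x, necklace_mx x \in unitmx.
Proof.
move=> S0U [i|u]; last exact: tau_mx_unit.
rewrite /necklace_mx; elim: {i}(nat_of_ord (_ - _)) => // k IHk.
by rewrite iterS /tau_conj !unitmx_mul IHk unitmx_inv tau_mx_unit.
Qed.

(** The braid relations among the [S i] are assumed here; they are later read off from [beta]. *)
Lemma necklace_mx_rel :
  (forall u v, @braid_rel n u v -> word_eval S u = word_eval S v) ->
  forall u v, necklace_rel u v -> word_eval necklace_mx u = word_eval necklace_mx v.
Proof.
move=> SP u v [] {u v}.
(* Both sides of (B1) are the same iterated conjugate of the two sides of the braid relation between
   sigma_1 and sigma_2. *)
- move=> i; rewrite /word_eval /= !mulmx1 necklace_mxD1 iterSr.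
  rewrite necklace_mxE -!iter_tau_conjM; congr iter.
  rewrite -/(iter 1 tau_conj _) (iter_tau_conj_sigma (Ordinal (isT : 1 < m.+2)%N)).
  by have := SP _ _ (@BraidB1 n ord0 (Ordinal (isT : 1 < m.+2)%N) erefl);
     rewrite /word_eval /= !mulmx1.
- move=> i j; rewrite /word_eval /= !mulmx1 !necklace_mxE.
  rewrite -{1 2}(subrK 1 i) -{1 2}(subrK 1 j); move: (i - 1) (j - 1) => {}i {}j.
  rewrite opprD addrACA subrr addr0.
  wlog ij : i j / (i <= j)%N.
    by have [ij|/ltnW ji] := leqP i j => H d1 d2;
      [apply: H | apply/esym/H; rewrite // -opprB eqr_oppLR // opprK].
  move=> d1 d2; rewrite -(subnKC ij) iterD -!iter_tau_conjM; congr iter.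
  (* What remains is that sigma_1 commutes with its conjugate by the power [d = j - i] of tau. The
     case [d = 0] is trivial, the hypotheses exclude [d = 1] and [d = n - 1], and otherwise the
     conjugate is sigma_(d+1), far from sigma_1. *)
  have [->//|k1] := eqVneq (j - i)%N 0.
  have [k2|k2] := eqVneq (j - i)%N 1.
    case/eqP: d2; rewrite -opprB; congr (- _); apply/eqP.
    have ji : j = i.+1 :> nat by rewrite -(subnKC ij) k2 addn1.
    have im : (i < m.+2)%N by rewrite -ltnS -ji ltn_ord.
    by rewrite subr_eq addrC ord_eqE val_ordD1 (ltn_eqF im) ji.
  have [k3|k3] := eqVneq (j - i)%N m.+2.
    case/eqP: d1; apply/eqP; rewrite subr_eq addrC ord_eqE val_ordD1.
    have i0 : i = 0%N :> nat.
      have : (j < 1 + m.+2)%N := ltn_ord j.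
      by rewrite -(subnKC ij) k3 ltn_add2r ltnS leqn0 => /eqP.
    by rewrite -(subnKC ij) k3 i0 eqxx.
  have km : (j - i < m.+2)%N.
    by rewrite ltn_neqAle k3 -ltnS (leq_ltn_trans (leq_subr _ _) (ltn_ord j)).
  rewrite (iter_tau_conj_sigma (Ordinal km)).
  have k4 : (1 < j - i)%N || ((j - i).+1 < 0)%N.
    by case: (j - i)%N k1 k2 => [|[]].
  by have := SP _ _ (@BraidB2 n ord0 (Ordinal km) k4); rewrite /word_eval /= !mulmx1.
- by move=> i; rewrite /word_eval /= !mulmx1 necklace_mxD1 /= mulmxA.
have evalT k : word_eval necklace_mx (nseq k (letter (gtau n))) = T ^+ k.
  by elim: k => //= k IHk; rewrite exprS -IHk.
by rewrite evalT mulnC exprM tau_mx_expn expr1n.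
Qed.

(** * Comparing tau with gamma *)

Lemma sigma_mx_delta (i : nat) (k : 'I_n) : (i < m.+2)%N ->
  S (inord i) *m e k =
    if k == i :> nat then e (inord i.+1)
    else if k == i.+1 :> nat then z *: e (inord i) else e k.
Proof.
move=> im; rewrite -colE; apply/matrixP => a c; rewrite ord1 !mxE sigma_mxE.
rewrite (inordK im).
have -> : (a == k) = (a == k :> nat) by [].
have [ki|ki] := eqVneq (k : nat) i.
  rewrite ki !mxE -val_eqE /= inordK // eqxx andbT.
  have [->|ai] := eqVneq (a : nat) i; first by rewrite !ltn_eqF.
  by case: (_ == _).
have [ki1|ki1] := eqVneq (k : nat) i.+1.
  rewrite !mxE -val_eqE /= inordK ?eqxx ?andbT; last exact: ltnW.
  have [ai|ai] := eqVneq (a : nat) i; first by rewrite mulr1.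
  by rewrite ki1 mulr0; case: (_ == _).
rewrite mxE andbT -[a == k]/(a == k :> nat).
have [->|ai] := eqVneq (a : nat) i; first by rewrite eq_sym (negPf ki).
by have [->|ai1] := eqVneq (a : nat) i.+1; first by rewrite eq_sym (negPf ki1).
Qed.

Let gamma_mx k : 'M[F]_n := \prod_(0 <= i < k) S (inord i).

(** All factors after the first fix [e 0], and the first sends it to [e 1]. *)
Lemma gamma_mx_first (k : nat) : (k < m.+2)%N -> gamma_mx k.+1 *m e 0 = e 1.
Proof.
elim: k => [|k IHk] km; rewrite /gamma_mx big_nat_recr //= -mulmxA sigma_mx_delta //=.
  by rewrite big_geq // mul1mx; congr (e _); apply: val_inj; rewrite /= inordK.
exact/IHk/ltnW.
Qed.

(** Each factor lowers the index of the basis vector by one and contributes a factor [z]. *)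
Lemma gamma_mx_last (k : 'I_n) : gamma_mx k *m e k = z ^+ k *: e 0.
Proof.
case: k => k; elim: k => [|k IHk] km.
  rewrite /gamma_mx big_geq // mul1mx expr0 scale1r.
  by congr (e _); apply: val_inj.
rewrite /gamma_mx big_nat_recr //= -mulmxA sigma_mx_delta //= eqxx gtn_eqF //.
rewrite -scalemxAr exprS -scalerA -(IHk (ltnW km)); congr (_ *: (_ *m e _)).
by apply: val_inj; rewrite /= inordK // ltnW.
Qed.

Lemma tau_mx_delta (k : 'I_n) :
  T *m e k = (t ^+ (k + 1)%R / t ^+ k) *: e (k + 1).
Proof.
rewrite -colE; apply/matrixP => a c; rewrite ord1 mxE tau_mxE !mxE eqxx andbT.
by case: eqP => [->|_]; rewrite ?mulr1 ?mulr0.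
Qed.

Lemma tau_mx_commuting_factor (A : 'M[F]_n) :
  z != 0 -> comm_mx A (S ord0) ->
  T = A *m \prod_(i < m.+2) S i -> t ^+ (2 * n) = z ^- (2 * n.-1).
Proof.
move=> z0 AS TA.
have gammaE : \prod_(i < m.+2) S i = gamma_mx m.+2.
  rewrite /gamma_mx big_mkord; apply: eq_bigr => i _; congr S.
  by apply: val_inj; rewrite /= inordK.
have S00 : S ord0 *m e 0 = e 1.
  have -> : ord0 = inord 0 :> 'I_m.+2 by apply: val_inj; rewrite /= inordK.
  by rewrite sigma_mx_delta //=; congr (e _); apply: val_inj; rewrite /= inordK.
have A1 : A *m e 1 = t *: e 1.
  rewrite -[in LHS](gamma_mx_first (ltnSn m.+1)) mulmxA -gammaE -TA tau_mx_delta add0r.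
  by rewrite divr1.
have A0 : z ^+ m.+2 *: (A *m e 0) = t ^- m.+2 *: e 0.
  rewrite scalemxAr -(gamma_mx_last ord_max) mulmxA -gammaE -TA tau_mx_delta.
  have -> : ord_max + 1 = 0 :> 'I_n by apply/eqP; rewrite ord_eqE val_ordD1 eqxx.
  by rewrite mul1r.
(* The vector [z^(n-1) A e_1] is computed in two ways, the second through
   [A S_0 e_0 = S_0 A e_0]. *)
have : z ^+ m.+2 *: (t *: e 1) = t ^- m.+2 *: e 1.
  rewrite -A1 -S00 mulmxA AS -mulmxA (scalemxAr (z ^+ _)) A0 -scalemxAr.
  by rewrite S00.
move/matrixP/(_ 1 0); rewrite !mxE !eqxx !mulr1 => zt.
have {}zt : t ^+ n = z ^- m.+2.
  apply: (mulfI (expf_neq0 m.+2 z0)); rewrite divff ?expf_neq0 //.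
  by rewrite exprS mulrA zt mulVf // expf_neq0.
(* Squaring [t^n = z^-(n-1)] gives the exponents of the theorem. *)
by rewrite mulnC exprM zt exprVn -exprM mulnC.
Qed.

End NecklaceMatrices.

(** Evaluating a word at the matrices is applying [beta] to its class, so the existence of [beta]
    yields the braid relations without matrix computation. *)
Lemma standard_word_eval (F : fieldType) (n : nat) (z : F)
    (beta : braid n -> 'M[F]_n) (u v : word 'I_n.-1) :
  standard_representation z beta ->
  pres_eq (@braid_rel n) u v ->
  word_eval (@sigma_mx F n z) u = word_eval (@sigma_mx F n z) v.
Proof.
move=> [betaP betaE] uv.
have evalE w : word_eval (@sigma_mx F n z) w = beta (pres_class _ w).
  elim: w => [|[x b] w IHw]; first by rewrite betaP.1.
  rewrite -cat1s -pres_mulE betaP.2 -IHw; congr (_ *m _) => /=.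
  rewrite -(betaE x); case: b => //.
  by rewrite pres_class_letterV representation_inv.
by rewrite !evalE; congr beta; apply/pres_classP.
Qed.

(** * Existence, uniqueness and non-standardness of [phi] *)

Theorem theorem3p2 (R : realType) (n : nat) (z : R[i])
    (beta : braid n -> 'M[R[i]]_n) (t : R[i]) :
  (3 <= n)%N -> z != 0 -> z != 1 -> standard_representation z beta -> t != 0 ->
  let assignments (phi : necklace n -> 'M[R[i]]_n) :=
    [/\ forall i : 'I_n.-1, phi (necklace_sigma i.+1%:R) = beta (braid_sigma i),
        phi (necklace_tau n) = tau_mx n t
      & phi (necklace_sigma n%:R) =
          phi (necklace_tau n) *m phi (necklace_sigma n.-1%:R)
            *m invmx (phi (necklace_tau n))] in
  (exists! phi : necklace n -> 'M[R[i]]_n,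
     representation phi /\ assignments phi) /\
  (forall phi : necklace n -> 'M[R[i]]_n,
     representation phi -> assignments phi ->
     is_extension beta phi /\
     (t ^+ (2 * n) != z ^- (2 * n.-1) ->
        ~ standard_extension beta phi /\
        ~ (exists c : R[i], phi (necklace_tau n) = c *: beta (braid_gamma n)))).
Proof.
case: n beta => [|[|[|m]]] // beta _ z0 _ betaP t0 assignments.
(* The assignments determine [phi] on every generator; residue 0 is sigma_n, where the third
   assignment is used. *)
have ext phi : assignments phi -> forall x : necklace_gen m.+3,
    phi (pres_gen _ x) = necklace_mx z t x.
  case=> phiS phiT phin [i|[]]; last by rewrite [LHS]phiT.
  have phi_nat j : (j < m.+2)%N ->
      phi (necklace_sigma (j.+1%:R : 'Z_m.+3)) =
      necklace_mx z t (gsigma (j.+1%:R : 'Z_m.+3)).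
    move=> jm; rewrite (phiS (Ordinal jm)) betaP.2.
    by rewrite (necklace_mx_sigma _ t0 (Ordinal jm)).
  rewrite -(natr_Zp i) -[LHS]/(phi (necklace_sigma _)) -/(gsigma _).
  case: (nat_of_ord i) (ltn_ord i) => [|j] jm; last exact: phi_nat.
  have n0 : m.+3%:R = 0 :> 'Z_m.+3 by apply: pchar_Zp.
  rewrite mulr0n -n0 [LHS]phin phi_nat // phiT.
  by rewrite -[in RHS]natr1 necklace_mxD1.
split; last first.
  move=> phi phiP phiA; have [phiS phiT _] := phiA.
  split=> [|tz]; first by split.
  (* Both negative claims reduce to this one: a scalar multiple is the case where [A] is a scalar
     matrix. *)
  have no_factor A : comm_mx A (@sigma_mx _ m.+3 z ord0) ->
      tau_mx m.+3 t = A *m \prod_(i < m.+2) @sigma_mx _ m.+3 z i -> False.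
    by move=> AS /(tau_mx_commuting_factor t0 z0 AS)/eqP; apply/negP.
  split=> [[_ [A [AS]]]|[c]].
    rewrite phiT representation_prod // (eq_bigr (@sigma_mx _ m.+3 z)).
      by apply: no_factor; rewrite -betaP.2 -phiS.
    by move=> i _; rewrite phiS betaP.2.
  rewrite phiT (representation_prod _ betaP.1).
  rewrite (eq_bigr (@sigma_mx _ m.+3 z)) => [|i _]; last exact: betaP.2.
  by rewrite -mul_scalar_mx; apply/no_factor/comm_scalar_mx.
have [||phi [phiP phiE]] :=
  @presented_representation _ _ _ (@necklace_rel m.+3) (necklace_mx z t).
- apply: necklace_mx_unit => //.
  by rewrite -betaP.2; apply/representation_unit/betaP.1.
- by apply: necklace_mx_rel => // u v uv; apply: (standard_word_eval betaP); apply: PresRel.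
have phiA : assignments phi.
  split=> [i||]; rewrite ?betaP.2 [LHS]phiE //; first exact: necklace_mx_sigma.
  by rewrite [X in invmx X]phiE -[m.+3%:R]natr1 necklace_mxD1 //= !phiE.
exists phi; split=> // phi' [phiP' phiA'].
by apply: representation_ext => // x; rewrite !ext.
Qed.
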